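(* Let $G$ be a primitive 4-point graph in $\phi^4$, and suppose the edge set of $G$ is partitioned into three parts $G_1,G_2,G_3$ (each regarded as the subgraph formed by those edges and their endpoints) such that: (i) $G_2\cup G_3$ is connected; (ii) $G_1\cup G_2$ and $G_3$ have exactly $n$ vertices in common, say $v_1,\dots,v_n$; (iii) exactly $v$ vertices of $G$ are endpoints of edges of $G_1$ but not of any edge of $G_2\cup G_3$; (iv) the edges of $G_1$ can be denominator reduced in $G$, i.e. there is an ordering $e_1,\dots,e_m$ of the edges of $G_1$ ($m=|G_1|\ge5$) such that $D=D^m_G(e_1,\dots,e_m)$ is defined and nonzero, and $D$ can be written as a signed sum of products of pairs of spanning forest polynomials of the graph $G_2\cup G_3$ in which no part of any partition contains a vertex of $G_3$ other than $v_1,\dots,v_n$; (v) $2\ell(G_2\cup G_3)-2\ell(G_3)+|G_1|-|G_2|-2v-2n+3\ge0$. Let $Q=\Phi^{\{v_1\},\dots,\{v_n\}}_{G_3}$ and let $\widetilde D$ be obtained from $D$ by substituting $a_e\mapsto a_eQ$ for every edge $e$ of $G_2$. Then $Q^{|G_2|+1}$ divides $\widetilde D$.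
   Context: A 4-point graph in $\phi^4$ is a connected graph $G$ obtained from a connected 4-regular graph by removing one vertex; it is primitive if every proper subgraph $\gamma$ with at least one edge satisfies $|E(\gamma)|>2\ell(\gamma)$, where $\ell$ is the first Betti number (number of independent cycles); $|G_i|$ denotes the number of edges of $G_i$. Each edge $e$ carries a variable $a_e$. For a graph $H$ and a partition $P$ of a subset of $V(H)$, $\mathcal F_{P,H}$ is the set of acyclic subgraphs $F$ with $V(F)=V(H)$, whose number of connected components equals the number of parts of $P$, such that each part of $P$ lies in one component containing no other vertices of $P$; the spanning forest polynomial is $\Phi^P_H=\sum_{F\in\mathcal F_{P,H}}\prod_{e\notin F}a_e$. Dodgson polynomials: with $M=\begin{bmatrix}\Lambda & \widetilde E^T\\ -\widetilde E & 0\end{bmatrix}$ ($\Lambda$ the diagonal matrix of edge variables, $\widetilde E$ the incidence matrix of an orientation of $G$ with one row removed), $\Psi^{I,J}_{G,K}=\det M(I,J)|_{a_e=0,e\in K}$ where $M(I,J)$ removes the rows indexed by edge set $I$ and columns indexed by edge set $J$, $|I|=|J|$. 5-invariant: ${}^5\Psi_G(i,j,k,l,m)=\pm(\Psi^{ij,kl}_{G,m}\Psi^{ikm,jlm}_G-\Psi^{ik,jl}_{G,m}\Psi^{ijm,klm}_G)$. Denominator reduction: $D^5_G(i_1,\dots,i_5)={}^5\Psi_G(i_1,\dots,i_5)$; if $D^n_G(i_1,\dots,i_n)=(Aa_\ell+B)(Ca_\ell+D)$ with $A,B,C,D$ polynomials (possibly zero) not involving $a_\ell$, then $D^{n+1}_G(i_1,\dots,i_n,\ell)=\pm(AD-BC)$.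 *)

(* Defs.v *)
From HB Require Import structures.
From mathcomp Require Import all_boot all_order all_algebra.
From mathcomp Require Import mpoly.
Set Implicit Arguments. Unset Strict Implicit. Unset Printing Implicit Defensive.
Import Order.TTheory GRing.Theory Num.Theory.
Local Open Scope ring_scope.

(* A (multi)graph: vertices 'I_nv, edges 'I_ne, each edge e has endpoints
   src e and dst e; (src e, dst e) also fixes an orientation of e.
   Edge variables a_e are the polynomial variables 'X_e of {mpoly int[ne]}.
   A subgraph is given by a set of edges together with their endpoints. *)

Section Graph.
Variables (nv ne : nat) (src dst : 'I_ne -> 'I_nv).

Definition vset (S : {set 'I_ne}) : {set 'I_nv} :=
  [set x | [exists e in S, (src e == x) || (dst e == x)]].

Definition adj (S : {set 'I_ne}) : rel 'I_nv :=
  fun x y => [exists e in S,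
    ((src e == x) && (dst e == y)) || ((src e == y) && (dst e == x))].

Definition ncomp_on (S : {set 'I_ne}) (A : {set 'I_nv}) : nat :=
  n_comp (adj S) (mem A).

Definition betti (S : {set 'I_ne}) : nat :=
  ((#|S| + ncomp_on S (vset S)) - #|vset S|)%N.

Definition acyclic (S : {set 'I_ne}) : bool := betti S == 0%N.

Definition sub_connected (S : {set 'I_ne}) : Prop :=
  forall x y, x \in vset S -> y \in vset S -> connect (adj S) x y.

Definition graph_connected : Prop := forall x y, connect (adj setT) x y.

Definition deg (x : 'I_nv) : nat :=
  (#|[set e | src e == x]| + #|[set e | dst e == x]|)%N.

Definition primitive : Prop :=
  forall S : {set 'I_ne}, S \proper setT -> S != set0 -> (2 * betti S < #|S|)%N.

Definition valid_partition (H : {set 'I_ne}) (P : seq {set 'I_nv}) : Prop :=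
  (forall p, p \in P -> p != set0 /\ p \subset vset H) /\
  (forall i j, (i < size P)%N -> (j < size P)%N -> i != j ->
     [disjoint nth set0 P i & nth set0 P j]).

Definition in_forests (H : {set 'I_ne}) (P : seq {set 'I_nv})
    (F : {set 'I_ne}) : bool :=
  [&& F \subset H, acyclic F,
      ncomp_on F (vset H) == size P,
      all (fun p : {set 'I_nv} => [forall x in p, forall y in p, connect (adj F) x y]) P &
      [forall i : 'I_(size P), forall j : 'I_(size P), (i != j) ==>
        [forall x in nth set0 P i, forall y in nth set0 P j,
           ~~ connect (adj F) x y]]].

Definition Phi (H : {set 'I_ne}) (P : seq {set 'I_nv}) : {mpoly int[ne]} :=
  \sum_(F : {set 'I_ne} | in_forests H P F) \prod_(e in H :\: F) 'X_e.

(* M = [[Lambda, E~^T], [-E~, 0]], indices 0..ne-1 are the edges (in order),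
   index ne + x is the vertex bump v0 x (vertex v0's row is removed). *)
Variable v0 : 'I_nv.

Definition inc (x e : nat) : {mpoly int[ne]} :=
  match @insub _ (fun i => i < ne)%N 'I_ne e with
  | Some e' => ((src e' == bump v0 x :> nat)%:R - (dst e' == bump v0 x :> nat)%:R)
  | None => 0
  end.

Definition Mentry (K : seq 'I_ne) (i j : nat) : {mpoly int[ne]} :=
  if (i < ne)%N then
    if (j < ne)%N then
      (if i == j then
         match @insub _ (fun k => k < ne)%N 'I_ne i with
         | Some e => if e \in K then 0 else 'X_e
         | None => 0 end
       else 0)
    else inc (j - ne) i
  else if (j < ne)%N then - inc (i - ne) j else 0.

Definition msize_tot : nat := (ne + nv.-1)%N.

Definition Dodgson (I J K : seq 'I_ne) : {mpoly int[ne]} :=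
  let rows := [seq i <- iota 0 msize_tot | i \notin map val I] in
  let cols := [seq j <- iota 0 msize_tot | j \notin map val J] in
  if size rows == size cols then
    \det (\matrix_(r < size rows, c < size rows)
            Mentry K (nth 0%N rows r) (nth 0%N cols c))
  else 0.

Definition five_inv (i j k l m : 'I_ne) : {mpoly int[ne]} :=
  Dodgson [:: i; j] [:: k; l] [:: m] * Dodgson [:: i; k; m] [:: j; l; m] [::]
  - Dodgson [:: i; k] [:: j; l] [:: m] * Dodgson [:: i; j; m] [:: k; l; m] [::].

Definition free_of (l : 'I_ne) (p : {mpoly int[ne]}) : Prop :=
  forall m, m \in msupp p -> m l = 0%N.

(* DR es D : D is (a choice of sign of) D^n_G(es) *)
Inductive DR : seq 'I_ne -> {mpoly int[ne]} -> Prop :=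
| DR5 (i j k l m : 'I_ne) (s : bool) :
    DR [:: i; j; k; l; m] ((-1) ^+ s * five_inv i j k l m)
| DRstep (es : seq 'I_ne) (l : 'I_ne) (A B C D : {mpoly int[ne]}) (s : bool) :
    DR es ((A * 'X_l + B) * (C * 'X_l + D)) ->
    free_of l A -> free_of l B -> free_of l C -> free_of l D ->
    DR (rcons es l) ((-1) ^+ s * (A * D - B * C)).

End Graph.

Definition four_point (nv ne : nat) (src dst : 'I_ne -> 'I_nv) : Prop :=
  graph_connected src dst /\
  exists (ne' : nat) (src' dst' : 'I_ne' -> 'I_nv.+1) (w : 'I_nv.+1)
         (f : 'I_ne -> 'I_ne'),
    (forall x, deg src' dst' x = 4%N) /\
    graph_connected src' dst' /\
    injective f /\
    (forall e', src' e' != w -> dst' e' != w -> exists e, f e = e') /\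
    (forall e, ((src' (f e) == lift w (src e)) && (dst' (f e) == lift w (dst e)))
            || ((src' (f e) == lift w (dst e)) && (dst' (f e) == lift w (src e)))).

(* Main.v *)
Require Import Defs.
From HB Require Import structures.
From mathcomp Require Import all_boot all_order all_algebra.
From mathcomp Require Import perm mpoly zify.
Import Order.TTheory GRing.Theory Num.Theory.
Local Open Scope ring_scope.
Set Implicit Arguments. Unset Strict Implicit.

(** The polynomial D is homogeneous of degree 2 l(G) - |G1|: this holds for the
    five-invariant by scaling rows and columns of the matrix, and each reduction
    step lowers the degree by one.  Hence in the given expression of D only
    products Phi^P Phi^P' of that degree matter, which fixes |P| + |P'|.

    A forest F of G2 u G3 counted by Phi^P meets G3 in a forest F3 each of whose
    components contains some v_i.  The substitution multiplies the monomial of F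
    by Q^|G2 \ F|.  If F3 has fewer than n components, F has an extra edge in G3
    compared with the case of n components, hence one edge less in G2, which
    gives one more factor Q.  If F3 has n components, the v_i are separated in
    F3, whether F is counted by Phi^P depends only on its edges in G2, and so
    the sum over F3 factors out as Q itself.  In both cases Phi^P gains at least
    |G2| + |V(G3)| + 1 + |P| - |V(G2 u G3)| - n factors Q, and condition (v) says
    that these exponents add up to at least |G2| + 1. *)

(** * Homogeneity of the denominator reductions *)

(** Integer coefficients have forced images. Identities between ring morphisms are checked on the
    variables through this. *)
Lemma mpoly_int_rmorph_eq (n : nat) (S : comNzRingType)
    (f g : {rmorphism {mpoly int[n]} -> S}) :
  (forall i, f 'X_i = g 'X_i) -> f =1 g.
Proof.
move=> fgX p; rewrite [p]mpolyE !rmorph_sum; apply: eq_bigr => m _ /=.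
rewrite -mul_mpolyC mpolyXE_id !rmorphM !rmorph_prod /=; congr (_ * _).
  by rewrite -[p@_m]intz !rmorph_int.
by apply: eq_bigr => i _; rewrite !rmorphXn /= fgX.
Qed.

Lemma mpolyX_neq0 (n : nat) (R : nzRingType) (m : 'X_{1..n}) :
  'X_[m] != 0 :> {mpoly R[n]}.
Proof. by rewrite -msupp_eq0 msuppX. Qed.

Section Homogenization.
Variable n : nat.
Local Notation mp := {mpoly int[n]}.

(** Write T for the variable of the outer polynomial ring. Each edge variable a goes to a T, so the
    coefficient of T^d is the homogeneous part of degree d. *)
Definition homogenize : mp -> {poly mp} :=
  mmap (polyC \o @mpolyC n int) (fun i => 'X_i *: 'X).

HB.instance Definition _ := GRing.RMorphism.copy homogenize
  (mmap (polyC \o @mpolyC n int) (fun i => 'X_i *: 'X)).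

Lemma homogenizeX i : homogenize 'X_i = ('X_i : mp) *: 'X.
Proof. by rewrite /homogenize mmapX mmap1U. Qed.

Lemma homogenize_eval1 p : (homogenize p).[1] = p.
Proof.
apply: (mpoly_int_rmorph_eq (f := horner_eval 1 \o homogenize) (g := idfun)) => i.
by rewrite /= /horner_eval homogenizeX hornerZ hornerX mulr1.
Qed.

(* Either p = 0 or p is homogeneous of degree b - a; the two exponents avoid
   truncated subtraction. *)
Definition homog_deg (a b : nat) (p : mp) := homogenize p * 'X^a = p *: 'X^b.

Definition kill (l : 'I_n) (p : mp) : mp :=
  p \mPo [tuple (if i == l then 0 else 'X_i) | i < n].

HB.instance Definition _ l := GRing.RMorphism.copy (kill l)
  (comp_mpoly [tuple (if i == l then 0 else 'X_i : mp) | i < n]).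

Lemma killX l i : kill l 'X_i = if i == l then 0 else 'X_i.
Proof. by rewrite /kill comp_mpolyXU -tnth_nth tnth_mktuple. Qed.

Lemma kill_free l p : free_of l p -> kill l p = p.
Proof.
move=> pl; rewrite /kill comp_mpolyEX [RHS]mpolyE; apply: eq_big_seq => m mp.
congr (_ *: _); rewrite comp_mpolyX mpolyXE_id; apply: eq_bigr => i _.
rewrite tnth_mktuple; case: eqP => // ->.
by rewrite pl // !expr0.
Qed.

Lemma homogenize_kill l p : map_poly (kill l) (homogenize p) = homogenize (kill l p).
Proof.
apply: (mpoly_int_rmorph_eq (f := map_poly (kill l) \o homogenize)
          (g := homogenize \o kill l)) => i /=.
rewrite homogenizeX map_polyZ /= map_polyX /= !killX.
by case: eqP => _; rewrite ?rmorph0 ?homogenizeX ?scale0r.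
Qed.

Lemma polyZXn_inj (R : idomainType) (c d : R) (a b : nat) :
  c != 0 -> c *: 'X^a = d *: 'X^b -> a = b.
Proof.
move=> c0 /(congr1 (fun p : {poly R} => p`_a)).
rewrite !coefZ !coefXn eqxx mulr1; case: eqP => // _.
by rewrite mulr0 => /eqP; rewrite (negPf c0).
Qed.

Lemma polyZXnM (R : comNzRingType) (c d : R) (a b : nat) :
  (c *: 'X^a) * (d *: 'X^b) = (c * d) *: 'X^(a + b).
Proof. by rewrite -scalerAl -scalerAr scalerA exprD. Qed.

Lemma polyZXnMX (R : comNzRingType) (c : R) (a b : nat) :
  (c *: 'X^a) * 'X^b = c *: 'X^(a + b).
Proof. by rewrite -scalerAl exprD. Qed.

Lemma mul_monomial (R : comNzRingType) (P Q : {poly R}) (p q : R) (a b c d : nat) :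
  P * 'X^a = p *: 'X^b -> Q * 'X^c = q *: 'X^d ->
  P * Q * 'X^(a + c) = (p * q) *: 'X^(b + d).
Proof. by move=> hP hQ; rewrite exprD mulrACA hP hQ polyZXnM. Qed.

(** The hypotheses encode degrees k - 1, k, j - 1, j for A, B, C, D, so both products in the
    resultant have degree k + j - 1. *)
Lemma resultant_monomial (R : comNzRingType) (A B C D : {poly R}) (a b c d : R)
    (k j m : nat) :
  A * 'X = a *: 'X^k -> B = b *: 'X^k -> C * 'X = c *: 'X^j -> D = d *: 'X^j ->
  (A * D - B * C) * 'X^(m.+1) = (a * d - b * c) *: 'X^(k + j + m).
Proof.
move=> hA hB hC hD; rewrite exprS mulrA mulrBl [A * D * 'X]mulrAC hA hD.
by rewrite -[B * C * 'X]mulrA hC hB !polyZXnM -scalerBl polyZXnMX.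
Qed.

Lemma polyZ_inj (R : idomainType) (c : R) :
  c != 0 -> injective (fun p : {poly R} => c *: p).
Proof.
by move=> c0 p q /=; rewrite -!mul_polyC; apply: mulfI; rewrite polyC_eq0.
Qed.

(** Over a domain, a divisor of a power of T is a power of T up to scalars, and evaluation at 1
    identifies the scalar. *)
Lemma dvdp_monomial (R : idomainType) (u w : {poly R}) (c : R) (b : nat) :
  c != 0 -> u * w = c *: 'X^b -> exists k, u = u.[1] *: 'X^k.
Proof.
move=> c0 uw.
have : u %| ('X - 0%:P) ^+ b.
  by rewrite subr0 -(dvdpZr _ _ c0) -uw dvdp_mulr.
case/dvdp_exp_XsubCP=> k _ /eqpP [[c1 c2] /= /andP [c1_0 _]].
rewrite subr0 => e; exists k.
have := congr1 (horner^~ 1) e; rewrite !hornerZ hornerXn expr1n mulr1 => e1.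
apply: (polyZ_inj c1_0); rewrite /= e -e1 -scalerA //.
Qed.

(* As A and B do not involve 'X_l, setting 'X_l to 0 isolates B. *)
Lemma homog_deg_linear (l : 'I_n) (A B : mp) k :
  free_of l A -> free_of l B ->
  homogenize (A * 'X_l + B) = (A * 'X_l + B) *: 'X^k ->
  homogenize A * 'X = A *: 'X^k /\ homogenize B = B *: 'X^k.
Proof.
move=> fA fB e.
have hB : homogenize B = B *: 'X^k.
  move/(congr1 (map_poly (kill l))): (e).
  rewrite homogenize_kill map_polyZ /= map_polyXn.
  by rewrite rmorphD rmorphM /= killX eqxx mulr0 add0r kill_free.
split=> //; move: e; rewrite rmorphD rmorphM /= hB homogenizeX scalerDl => /addIr.
rewrite -scalerAr [A * _]mulrC -scalerA; apply: polyZ_inj.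
exact: mpolyX_neq0.
Qed.

(** The factors of a nonzero homogeneous product are homogeneous, say of degrees k and j; the
    resultant then has degree k + j - 1. *)
Lemma homog_deg_resultant (l : 'I_n) (A B C D : mp) (a b : nat) :
  free_of l A -> free_of l B -> free_of l C -> free_of l D ->
  homog_deg a b ((A * 'X_l + B) * (C * 'X_l + D)) -> homog_deg a.+1 b (A * D - B * C).
Proof.
move=> fA fB fC fD.
have unlin (U V : mp) : free_of l U -> free_of l V -> U * 'X_l + V = 0 ->
    (U = 0) * (V = 0).
  move=> fU fV e; have V0 : V = 0.
    have := congr1 (kill l) e.
    by rewrite rmorphD rmorphM /= killX eqxx mulr0 add0r kill_free ?rmorph0.
  split=> //; move/eqP: e; rewrite V0 addr0 mulf_eq0 (negPf (mpolyX_neq0 _ _)) orbF.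
  by move/eqP.
rewrite /homog_deg.
(* If the product is 0, one factor vanishes together with both of its coefficients, so the resultant
   is 0 and satisfies [homog_deg] for all exponents. *)
have [/eqP|nz] := eqVneq ((A * 'X_l + B) * (C * 'X_l + D)) 0.
  rewrite mulf_eq0 => /orP [] /eqP z _.
    have [-> ->] := unlin A B fA fB z.
    by rewrite !mul0r subrr rmorph0 mul0r scale0r.
  have [-> ->] := unlin C D fC fD z.
  by rewrite !mulr0 subrr rmorph0 mul0r scale0r.
rewrite rmorphM /= => e.
have [k ek] : exists k, homogenize (A * 'X_l + B) = (A * 'X_l + B) *: 'X^k.
  have := dvdp_monomial (u := homogenize (A * 'X_l + B))
    (w := homogenize (C * 'X_l + D) * 'X^a) nz.
  by rewrite homogenize_eval1 mulrA; apply; exact: e.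
have [j ej] : exists k, homogenize (C * 'X_l + D) = (C * 'X_l + D) *: 'X^k.
  have := dvdp_monomial (u := homogenize (C * 'X_l + D))
    (w := homogenize (A * 'X_l + B) * 'X^a) nz.
  by rewrite homogenize_eval1 mulrCA mulrA; apply; exact: e.
have kja : (k + j + a = b)%N.
  apply: (polyZXn_inj (d := (A * 'X_l + B) * (C * 'X_l + D)) nz).
  rewrite -e ek ej.
  by rewrite polyZXnM polyZXnMX.
have [hA hB] := homog_deg_linear fA fB ek.
have [hC hD] := homog_deg_linear fC fD ej.
rewrite rmorphB !rmorphM -kja /=.
exact: resultant_monomial.
Qed.

Lemma homog_degM a b c d p q : homog_deg a b p -> homog_deg c d q ->
  homog_deg (a + c) (b + d) (p * q).
Proof.
by rewrite /homog_deg rmorphM; apply: mul_monomial.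
Qed.

Lemma homog_degB a b p q : homog_deg a b p -> homog_deg a b q -> homog_deg a b (p - q).
Proof.
move=> hp hq; rewrite /homog_deg rmorphB mulrBl scalerBl.
exact: (congr2 (fun u v => u - v) hp hq).
Qed.

Lemma homog_deg_sign a b (s : bool) p : homog_deg a b p -> homog_deg a b ((-1) ^+ s * p).
Proof.
rewrite mulr_sign; case: s => // hp.
by rewrite /homog_deg rmorphN mulNr scaleNr; congr (- _).
Qed.

Lemma homog_deg_cancel a b k p : homog_deg (a + k) (b + k) p -> homog_deg a b p.
Proof.
rewrite /homog_deg exprD mulrA -polyZXnMX; apply: mulIf.
by rewrite -size_poly_eq0 size_polyXn.
Qed.

Lemma homog_degW a b k p : homog_deg a b p -> homog_deg (a + k) (b + k) p.
Proof. by rewrite /homog_deg exprD mulrA -polyZXnMX => ->. Qed.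

End Homogenization.

(** * Degrees of Dodgson polynomials and denominator reductions *)

(** Every permutation in the Leibniz expansion contributes the same exponent, the sum of all row and
    column weights. The N factors ['X] account for entries of degree r i + c j - 1. *)
Lemma det_monomial (R : comNzRingType) (N : nat) (P : 'M[{poly R}]_N)
    (M : 'M[R]_N) (r c : 'I_N -> nat) :
  (forall i j, P i j * 'X = M i j *: 'X^(r i + c j)) ->
  \det P * 'X^N = \det M *: 'X^(\sum_i r i + \sum_j c j).
Proof.
move=> hP; rewrite /determinant mulr_suml scaler_suml; apply: eq_bigr => s _.
have -> : 'X^N = \prod_(i < N) 'X :> {poly R} by rewrite prodr_const card_ord.
rewrite -mulrA -big_split /=.
under eq_bigr => i _ do rewrite hP.
have <- : (\sum_j c (s j) = \sum_j c j)%N.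
  by rewrite [RHS](reindex_inj (@perm_inj _ s)).
rewrite scaler_prod prodrXr big_split /=.
by rewrite !mulr_sign; case: ifP => _; rewrite ?scaleNr.
Qed.

Lemma count_mem_iota (ne : nat) (I : seq 'I_ne) :
  uniq I -> count (mem (map val I)) (iota 0 ne) = size I.
Proof.
move=> uI; rewrite -size_filter -(size_map val).
apply/perm_size/uniq_perm.
- by rewrite filter_uniq ?iota_uniq.
- by rewrite map_inj_uniq //; apply: val_inj.
move=> i; rewrite mem_filter mem_iota /= add0n andb_idr // => /mapP [x _ ->].
exact: ltn_ord.
Qed.

Section DodgsonDegree.
Variables (nv ne : nat) (src dst : 'I_ne -> 'I_nv) (v0 : 'I_nv).

Lemma filter_iota_notin (I : seq 'I_ne) :
  [seq i <- iota 0 (msize_tot nv ne) | i \notin map val I]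
  = [seq i <- iota 0 ne | i \notin map val I] ++ iota ne nv.-1.
Proof.
rewrite /msize_tot iotaD filter_cat add0n; congr (_ ++ _).
apply/all_filterP/allP => i; rewrite mem_iota => /andP [le_i _].
by apply/mapP => -[x _ e]; move: (ltn_ord x); rewrite -[X in (X < _)%N]e ltnNge le_i.
Qed.

Lemma size_filter_notin (I : seq 'I_ne) : uniq I ->
  (size [seq i <- iota 0 ne | i \notin map val I] = ne - size I)%N.
Proof.
move=> uI; rewrite size_filter -(count_mem_iota uI).
apply/eqP; rewrite -(eqn_add2l (count (mem (map val I)) (iota 0 ne))).
rewrite subnKC; last by rewrite -[leqRHS](size_iota 0 ne) count_size.
by rewrite count_predC size_iota.
Qed.

Lemma sum_row_weights (I : seq 'I_ne) (N : nat) :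
  uniq I ->
  let rows := [seq i <- iota 0 (msize_tot nv ne) | i \notin map val I] in
  N = size rows ->
  (\sum_(r < N) (nth 0 rows r < ne) = ne - size I)%N.
Proof.
move=> uI rows ->.
rewrite -(big_mkord xpredT (fun i => (nth 0 rows i < ne)%N : nat)).
rewrite -(big_nth 0 xpredT (fun i => (i < ne)%N : nat)) /rows filter_iota_notin.
rewrite big_cat /= -[RHS]addn0; congr (_ + _)%N.
  rewrite -(size_filter_notin uI) -sum1_size.
  apply: eq_big_seq => i; rewrite mem_filter mem_iota add0n.
  by case/and3P => _ _ ->.
apply: big1_seq => i /=; rewrite mem_iota => /andP [le_i _].
by rewrite ltnNge le_i.
Qed.

Lemma homogenize_inc x e : homogenize (inc src dst v0 x e) = (inc src dst v0 x e)%:P.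
Proof.
rewrite /inc; case: insub => [e'|]; last by rewrite !rmorph0.
by rewrite !rmorphB /= !rmorph_nat.
Qed.

(** Edge indices have weight 1 and vertex indices weight 0; the degree of an entry is its total
    weight minus 1. This gives 1 for the edge variables and 0 for the incidence entries, and the
    vertex-vertex block is zero. *)
Lemma homogenize_Mentry K i j :
  homogenize (Mentry src dst v0 K i j) * 'X
  = Mentry src dst v0 K i j *: 'X^((i < ne) + (j < ne)).
Proof.
rewrite /Mentry; case: (ltnP i ne) => hi; case: (ltnP j ne) => hj.
- case: eqP => _; last by rewrite rmorph0 mul0r scale0r.
  case: insub => [e|]; last by rewrite rmorph0 mul0r scale0r.
  by case: ifP => _; rewrite ?rmorph0 ?mul0r ?scale0r // homogenizeX -scalerAl.
- by rewrite homogenize_inc mul_polyC.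
- by rewrite rmorphN /= homogenize_inc mulNr mul_polyC scaleNr.
by rewrite rmorph0 mul0r scale0r.
Qed.

(** The weights add up to 2 (ne - |I|) and the matrix has size nv - 1 + ne - |I|, so the degree is
    ne - (nv - 1) - |I|. *)
Lemma homog_deg_Dodgson (I J K : seq 'I_ne) :
  uniq I -> uniq J -> size I = size J ->
  homog_deg (nv.-1 + size I) ne (Dodgson src dst v0 I J K).
Proof.
move=> uI uJ sIJ.
have le_I : (size I <= ne)%N by rewrite -[leqRHS](card_ord ne) -(card_uniqP uI) max_card.
rewrite /Dodgson; set rows := filter _ _; set cols := filter _ _.
case: eqP => [e|_]; last by rewrite /homog_deg rmorph0 mul0r scale0r.
have szr : size rows = (nv.-1 + (ne - size I))%N.
  by rewrite /rows filter_iota_notin size_cat size_filter_notin // size_iota addnC.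
set d := \det _.
suff h : homog_deg (size rows) (ne - size I + (ne - size J)) d.
  have h1 : homog_deg nv.-1 (ne - size I) d.
    by apply: (@homog_deg_cancel _ _ _ (ne - size I)); rewrite -szr {2}sIJ.
  by have := @homog_degW _ _ _ (size I) _ h1; rewrite subnK.
rewrite /d; clear d.
rewrite -(sum_row_weights uJ e) -(sum_row_weights uI (erefl (size rows))).
rewrite /homog_deg -det_map_mx.
by apply: det_monomial => i j; rewrite !mxE homogenize_Mentry.
Qed.

(** Each product pairs a Dodgson polynomial with |I| = 2 and one with |I| = 3, so the degree is 2
    (ne - (nv - 1)) - 5. *)
Lemma homog_deg_five_inv i j k l m : uniq [:: i; j; k; l; m] ->
  homog_deg (nv.-1.*2 + 5) ne.*2 (five_inv src dst v0 i j k l m).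
Proof.
rewrite /= !inE !negb_or -!andbA.
case/and5P=> ij ik il im /and5P [jk jl jm kl /and3P [km lm _]].
have mul2 (I J I' J' K K' : seq 'I_ne) : uniq I -> uniq J -> uniq I' -> uniq J' ->
    size I = 2%N -> size J = 2%N -> size I' = 3%N -> size J' = 3%N ->
    homog_deg (nv.-1.*2 + 5) ne.*2
      (Dodgson src dst v0 I J K * Dodgson src dst v0 I' J' K').
  move=> uI uJ uI' uJ' sI sJ sI' sJ'.
  have -> : (nv.-1.*2 + 5 = nv.-1 + 2 + (nv.-1 + 3))%N by rewrite addnACA addnn.
  rewrite -addnn -{1}sI -{1}sI'.
  by apply: homog_degM; apply: homog_deg_Dodgson => //; rewrite ?sI ?sI' ?sJ ?sJ'.
apply: homog_degB; apply: mul2 => //=; rewrite !inE ?negb_or.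
all: by rewrite ?ij ?ik ?il ?im ?jk ?jl ?jm ?kl ?km ?lm.
Qed.

Lemma homog_deg_DR es D : DR src dst v0 es D -> uniq es ->
  homog_deg (nv.-1.*2 + size es) ne.*2 D.
Proof.
elim=> [i j k l m s u|{}es l A B C {}D s _ IH fA fB fC fD].
  exact/homog_deg_sign/homog_deg_five_inv.
rewrite rcons_uniq size_rcons addnS => /andP [_ u]; apply: homog_deg_sign.
exact: (homog_deg_resultant fA fB fC fD (IH u)).
Qed.
End DodgsonDegree.

(** * Counting components of forests *)

Lemma connect_invariant (T T' : finType) (e : rel T) (f : T -> T') :
  (forall x y, e x y -> f x = f y) -> forall x y, connect e x y -> f x = f y.
Proof.
move=> fe x y /connectP [p]; elim: p x => [|z p IH] x /=; first by move=> _ ->.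
by case/andP=> /fe -> /IH; apply.
Qed.

Lemma card_imset_ker (T T1 T2 : finType) (W : {set T}) (f : T -> T1) (g : T -> T2) :
  {in W &, forall x y, f x = f y <-> g x = g y} -> #|f @: W| = #|g @: W|.
Proof.
have le (U1 U2 : finType) (h : T -> U1) (k : T -> U2) :
    {in W &, forall x y, h x = h y <-> k x = k y} -> (#|h @: W| <= #|k @: W|)%N.
  move=> hk; have [->|[x0 _]] := set_0Vmem W; first by rewrite !imset0 !cards0.
  (* On W the map h factors through k: u evaluates h at a chosen preimage under k. *)
  pose u z := h (odflt x0 [pick x in W | k x == z]).
  suff -> : h @: W = u @: (k @: W) by apply: leq_imset_card.
  rewrite -imset_comp; apply: eq_in_imset => x xW; rewrite /u /=.
  case: pickP => [y /andP [yW /eqP e]|/(_ x)]; last by rewrite xW eqxx.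
  by apply/hk.
move=> fg; apply/eqP; rewrite eqn_leq !le // => x y xW yW.
by split=> /fg; apply.
Qed.

(** W meets every component inside [a], possibly several times, so the roots of its points are
    exactly the roots in [a]. *)
Lemma n_comp_transversal (T : finType) (e : rel T) (a : pred T) (W : {set T}) :
  connect_sym e -> closed e a -> {subset W <= a} ->
  (forall x, x \in a -> exists2 y, y \in W & connect e x y) ->
  fingraph.n_comp e a = #|fingraph.root e @: W|.
Proof.
move=> se ca Wa aW; apply: eq_card => y; rewrite !inE.
apply/andP/imsetP => [[/eqP ry ya]|[x xW ->]].
  have [w wW /(fingraph.rootP se) yw] := aW y ya.
  by exists w; rewrite // -yw.
rewrite fingraph.roots_root //; split=> //.
have xa : x \in a by apply: Wa.
by have := closed_connect ca (connect_root e x); rewrite xa => <-.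
Qed.

Section Forests.
Variables (nv ne : nat) (src dst : 'I_ne -> 'I_nv).
Implicit Types S H F : {set 'I_ne}.
Local Notation adj := (adj src dst).
Local Notation vset := (vset src dst).

(** Isolated vertices count as components, so that different edge sets are compared over one fixed
    vertex set. *)
Definition ncomp S : nat := n_comp (adj S) 'I_nv.

Lemma adj_sym S : ssrbool.symmetric (adj S).
Proof. by move=> x y; apply: eq_existsb => e; rewrite orbC. Qed.

Lemma connect_adj_sym S : connect_sym (adj S).
Proof. exact/sym_connect_sym/adj_sym. Qed.

Lemma adj_vset S x y : adj S x y -> x \in vset S /\ y \in vset S.
Proof.
case/existsP => e /andP [eS exy]; split; rewrite inE; apply/existsP; exists e.
  by rewrite eS; case/orP: exy => /andP [h1 h2]; rewrite ?h1 ?h2 ?orbT.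
by rewrite eS; case/orP: exy => /andP [h1 h2]; rewrite ?h1 ?h2 ?orbT.
Qed.

Lemma adjW S S' : S \subset S' -> subrel (adj S) (adj S').
Proof.
move=> sub x y /existsP [e /andP [eS exy]]; apply/existsP; exists e.
by rewrite (subsetP sub).
Qed.

Lemma connect_adjW S S' : S \subset S' ->
  subrel (connect (adj S)) (connect (adj S')).
Proof. by move=> /adjW sub; apply: connect_sub => x y /sub /connect1. Qed.

Lemma vsetW S S' : S \subset S' -> vset S \subset vset S'.
Proof.
move=> sub; apply/subsetP => x; rewrite !inE => /existsP [e /andP [eS ex]].
by apply/existsP; exists e; rewrite (subsetP sub).
Qed.

Lemma vsetU S S' : vset (S :|: S') = vset S :|: vset S'.
Proof.
apply/setP=> x; rewrite !inE; apply/existsP/orP.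
  by case=> e; rewrite inE andb_orl => /orP [] h; [left|right];
    apply/existsP; exists e.
by case=> /existsP [e /andP [eS ex]]; exists e; rewrite inE eS ?orbT.
Qed.

Lemma closed_vset S H : S \subset H -> closed (adj S) (mem (vset H)).
Proof.
move=> sub; apply: (intro_closed (connect_adj_sym S)) => x y xy _.
by have [_ /(subsetP (vsetW sub))] := adj_vset xy.
Qed.

Lemma ncomp_root S : ncomp S = #|fingraph.root (adj S) @: [set: 'I_nv]|.
Proof.
apply: n_comp_transversal => //; first exact: connect_adj_sym.
by move=> x _; exists x.
Qed.

Lemma ncomp_setU1 S e : (ncomp S <= (ncomp (e |: S)).+1)%N.
Proof.
have sy := connect_adj_sym S.
pose r := fingraph.root (adj S).
(* f merges the components of the endpoints of e, hence is constant on the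
   components of e |: S. *)
pose f x := if connect (adj S) x (src e) then r (dst e) else r x.
have fadj x y : adj (e |: S) x y -> f x = f y.
  have fS a b : connect (adj S) a b -> f a = f b.
    move=> ab; rewrite /f (same_connect sy ab); case: ifP => // _.
    exact/(fingraph.rootP sy).
  have fe : f (src e) = f (dst e).
    by rewrite /f connect0; case: ifP.
  case/existsP => g /andP [/setU1P [->|gS] gxy].
    by case/orP: gxy => /andP [/eqP <- /eqP <-].
  by apply/fS/connect1/existsP; exists g; rewrite gS.
have lef : (#|f @: setT| <= ncomp (e |: S))%N.
  rewrite ncomp_root; suff -> : f @: setT = f @: (fingraph.root (adj (e |: S)) @: setT).
    exact: leq_imset_card.
  rewrite -imset_comp; apply: eq_in_imset => x _ /=.
  exact/(connect_invariant fadj)/connect_root.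
(* Only the old root of [src e] can be missing from the image of f. *)
apply: (@leq_trans #|f @: setT :|: [set r (src e)]|); last first.
  by rewrite (leq_trans (leq_card_setU _ _)) // cards1 addn1.
rewrite ncomp_root; apply/subset_leq_card/subsetP => _ /imsetP [x _ ->].
rewrite !inE; have [xs|nxs] := boolP (connect (adj S) x (src e)).
  by rewrite (fingraph.rootP sy xs) eqxx orbT.
by apply/orP; left; apply/imsetP; exists x; rewrite // /f (negPf nxs).
Qed.

Lemma connect_isolated S x y : x \notin vset S -> connect (adj S) x y -> x = y.
Proof.
move=> xS /connectP [[|z p] /=]; first by [].
by case/andP=> /adj_vset [] /(negP xS).
Qed.

Lemma root_isolated S x : x \notin vset S -> fingraph.root (adj S) x = x.
Proof. by move=> xS; apply/esym/(connect_isolated xS)/connect_root. Qed.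

Lemma ncomp0 : ncomp set0 = nv.
Proof.
rewrite ncomp_root -[RHS]card_ord -cardsT; congr #|pred_of_set _|.
rewrite -[RHS]imset_id; apply: eq_in_imset => x _; apply: root_isolated.
by rewrite inE; apply/existsP => -[e]; rewrite inE.
Qed.

(** Adding an edge raises |S| by one and lowers the number of components by at most one. *)
Lemma card_ncompW S S' : S \subset S' -> (#|S| + ncomp S <= #|S'| + ncomp S')%N.
Proof.
move: {2}#|S' :\: S|.+1 (ltnSn #|S' :\: S|) => k.
elim: k S' => [//|k IH] S' lek sub.
have [/eqP|[e]] := set_0Vmem (S' :\: S).
  rewrite setD_eq0 => sub'; suff -> : S = S' by [].
  by apply/eqP; rewrite eqEsubset sub.
rewrite inE => /andP [eS eS'].
have sub1 : S \subset S' :\ e by rewrite subsetD1 sub eS.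
have := IH (S' :\ e); rewrite (cardsD1 e S') eS' sub1.
have := ncomp_setU1 (S' :\ e) e; rewrite (setD1K eS').
have : (#|(S' :\ e) :\: S| < k)%N.
  move: lek; rewrite (cardsD1 e (S' :\: S)) inE eS eS' /= add1n ltnS.
  by apply: leq_trans; rewrite ltnS subset_leq_card // setDDl setUC -setDDl.
move=> h1 h2 /(_ h1 isT); lia.
Qed.

Lemma nv_le_card_ncomp S : (nv <= #|S| + ncomp S)%N.
Proof. by have := card_ncompW (sub0set S); rewrite cards0 ncomp0. Qed.

Lemma card_setC_vset H : (#|vset H| + #|~: vset H| = nv)%N.
Proof. by rewrite cardsC card_ord. Qed.

(** A vertex outside H touches no edge of F and is a component by itself. *)
Lemma ncomp_on_vset F H : F \subset H ->
  ncomp F = (ncomp_on src dst F (vset H) + #|~: vset H|)%N.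
Proof.
move=> sub; rewrite /ncomp (n_compC (mem (vset H))); congr (_ + _)%N.
apply: eq_card => x; rewrite !inE andb_idl // => xH.
apply/eqP/root_isolated/negP => /(subsetP (vsetW sub)).
by rewrite inE (negPf xH).
Qed.

Lemma bettiE S : betti src dst S = (#|S| + ncomp S - nv)%N.
Proof.
rewrite /betti (ncomp_on_vset (subxx S)); have := card_setC_vset S; lia.
Qed.

Lemma acyclicE S : acyclic src dst S = (#|S| + ncomp S == nv)%N.
Proof. by rewrite /acyclic bettiE; have := nv_le_card_ncomp S; lia. Qed.

Lemma acyclicW S S' : S \subset S' -> acyclic src dst S' -> acyclic src dst S.
Proof.
rewrite !acyclicE => /card_ncompW; have := nv_le_card_ncomp S; lia.
Qed.

Lemma acyclic_card F H : F \subset H -> acyclic src dst F ->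
  (#|F| + ncomp_on src dst F (vset H) = #|vset H|)%N.
Proof.
move=> /ncomp_on_vset; rewrite acyclicE => e1 /eqP e2.
have := card_setC_vset H; lia.
Qed.

Lemma in_forests_card H P F : in_forests src dst H P F ->
  (#|F| + size P = #|vset H|)%N.
Proof. by case/and5P=> sub acF /eqP <- _ _; apply: acyclic_card. Qed.

Lemma in_forests_disconnected H P F i j x y : in_forests src dst H P F ->
  (i < size P)%N -> (j < size P)%N -> x \in nth set0 P i -> y \in nth set0 P j ->
  connect (adj F) x y -> i = j.
Proof.
case/and5P=> _ _ _ _ /forallP all_i iP jP xi yj xy; apply/eqP/negPn/negP => ij.
move: (all_i (Ordinal iP)) => /forallP /(_ (Ordinal jP)) /implyP.
move=> /(_ ij) /forallP /(_ x) /implyP /(_ xi) /forallP /(_ y) /implyP /(_ yj).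
by rewrite xy.
Qed.

(** Pigeonhole: representatives of the parts lie in distinct components of F, and there are as many
    components as parts, so every component is hit. *)
Lemma in_forests_covered H P F x :
  (forall p, p \in P -> p != set0 /\ p \subset vset H) ->
  in_forests src dst H P F -> x \in vset H ->
  exists p y, [/\ p \in P, y \in p & connect (adj F) x y].
Proof.
move=> vP FP xH; case/and5P: (FP) => sub _ /eqP nc _ _.
have sy := connect_adj_sym F; have cl := closed_vset sub.
have [f fP] : exists f : 'I_(size P) -> 'I_nv, forall i, f i \in nth set0 P i.
  exists (fun i => odflt x [pick y in nth set0 P i]) => i.
  case: pickP => //= h; have [] := vP _ (mem_nth set0 (ltn_ord i)).
  by case/set0Pn => y yP; have := h y; rewrite /= yP.
have injf : injective (fingraph.root (adj F) \o f).
  move=> i j /(fingraph.rootP sy) ij; apply: val_inj.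
  exact: (in_forests_disconnected FP (ltn_ord i) (ltn_ord j) (fP i) (fP j) ij).
have eqR : (fingraph.root (adj F) \o f) @: setT = fingraph.root (adj F) @: vset H.
  apply/eqP; rewrite eqEcard card_imset // cardsT card_ord.
  apply/andP; split; last first.
    move/eq_leq: nc; apply: leq_trans; rewrite /ncomp_on (n_comp_transversal (W := vset H)) //.
    by move=> y yH; exists y.
  apply/subsetP=> _ /imsetP [i _ ->]; apply/imsetP; exists (f i) => //.
  have [_ /subsetP] := vP _ (mem_nth set0 (ltn_ord i)); exact.
have /imsetP [i _ /(fingraph.rootP sy) xi] :
    fingraph.root (adj F) x \in (fingraph.root (adj F) \o f) @: setT.
  by rewrite eqR imset_f.
by exists (nth set0 P i), (f i); rewrite mem_nth.
Qed.

(** The monomial of F has degree |H| - |F|, and |F| = |V(H)| - |P|. *)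
Lemma homog_deg_Phi H P :
  homog_deg #|vset H| (#|H| + size P) (Phi src dst H P).
Proof.
rewrite /homog_deg /Phi rmorph_sum mulr_suml scaler_suml.
apply: eq_bigr => F FP /=.
have -> : (#|H| + size P = #|H :\: F| + #|vset H|)%N.
  rewrite -(in_forests_card FP); case/and5P: FP => sub _ _ _ _.
  by rewrite -(cardsID F H) (setIidPr sub); lia.
rewrite rmorph_prod /= -polyZXnMX; congr (_ * _).
under eq_bigr => e _ do rewrite homogenizeX.
rewrite scaler_prod prodr_const; congr (_ *: 'X^ _).
Qed.
End Forests.

(** * Cutting a forest at the common vertices *)

Section Separation.
Variables (nv ne : nat) (src dst : 'I_ne -> 'I_nv).
Variables (G2 G3 : {set 'I_ne}) (vs : seq 'I_nv).
Local Notation adj := (adj src dst).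
Local Notation vset := (vset src dst).
Local Notation forests := (in_forests src dst).
Local Notation singles := [seq [set x] | x <- vs].

Hypothesis disG : [disjoint G2 & G3].
Hypothesis uniq_vs : uniq vs.
Hypothesis vs_sub : {subset vs <= vset G3}.
Hypothesis vs_sep : forall x, x \in vset G2 -> x \in vset G3 -> x \in vs.

Section Restriction.
Variables (P : seq {set 'I_nv}) (F : {set 'I_ne}).
Hypothesis vP : forall p, p \in P -> p != set0 /\ p \subset vset (G2 :|: G3).
Hypothesis P_vs : forall p x, p \in P -> x \in p -> x \in vset G3 -> x \in vs.
Hypothesis FP : forests (G2 :|: G3) P F.

(** Suppose the component of x in F ∩ G3 avoids [vs]. No edge of G2 can touch it, so it is a whole
    component of F and contains a vertex of some part of P. That vertex lies in G3, hence in [vs], a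
    contradiction. *)
Lemma restriction_reaches_vs x : x \in vset G3 ->
  exists2 y, y \in vs & connect (adj (F :&: G3)) x y.
Proof.
move=> x3; have [/exists_inP [y yv xy]|none] :=
  boolP [exists y in vs, connect (adj (F :&: G3)) x y]; first by exists y.
have cl3 := closed_vset (src := src) (dst := dst) (subsetIr F G3).
have stay y : connect (adj (F :&: G3)) x y -> y \in vset G3.
  by move=> xy; have := closed_connect cl3 xy; rewrite x3 => <-.
have cl : closed (adj F) (connect (adj (F :&: G3)) x).
  apply: (intro_closed (connect_adj_sym _ _ F)) => a b ab xa.
  case/existsP: (ab) => e /andP [eF eab].
  have [e2|e2] := boolP (e \in G2).
    have [a2 _] : a \in vset G2 /\ b \in vset G2.
      by apply: adj_vset; apply/existsP; exists e; rewrite e2.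
    case/exists_inP: none; exists a => //.
    by apply: vs_sep => //; apply: stay.
  apply: connect_trans xa (connect1 _); apply/existsP; exists e; rewrite inE eF.
  case/and5P: FP => /subsetP /(_ e eF); rewrite inE (negPf e2) /= => -> _ _ _ _.
  exact: eab.
have xH : x \in vset (G2 :|: G3) by rewrite vsetU inE x3 orbT.
have [p [y [pP yp xy]]] := in_forests_covered vP FP xH.
have xy3 : connect (adj (F :&: G3)) x y.
  have := closed_connect cl xy.
  by rewrite /in_mem /= connect0 => <-.
case/exists_inP: none; exists y => //.
by apply: (P_vs pP yp); apply: stay.
Qed.

(** The conclusion says that F ∩ G3 has fewer than n components. Otherwise, as each contains some
    v_i, there are exactly n and they separate the v_i. *)
Lemma restriction_forest_or_few :
  ~~ forests G3 singles (F :&: G3) ->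
  (#|vset G3| < #|F :&: G3| + size vs)%N.
Proof.
have acF : acyclic src dst (F :&: G3).
  by case/and5P: FP => _ acF _ _ _; apply: acyclicW acF; apply: subsetIl.
have sub := subsetIr F G3.
rewrite -(acyclic_card sub acF) ltn_add2l ltnNge; apply: contra => le_n.
have sy := connect_adj_sym src dst (F :&: G3).
have vsE : #|[set x in vs]| = size vs by rewrite cardsE; apply/card_uniqP.
have nE : ncomp_on src dst (F :&: G3) (vset G3)
          = #|fingraph.root (adj (F :&: G3)) @: [set x in vs]|.
  apply: n_comp_transversal => //; first exact: closed_vset.
    by move=> x; rewrite inE => /vs_sub.
  by move=> x /restriction_reaches_vs [y yv xy]; exists y; rewrite ?inE.
have nle : ncomp_on src dst (F :&: G3) (vset G3) = size vs.
  by apply/eqP; rewrite eqn_leq le_n nE -vsE leq_imset_card.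
have /imset_injP inj_vs : #|fingraph.root (adj (F :&: G3)) @: [set x in vs]|
    == #|[set x in vs]| by rewrite -nE nle vsE.
apply/and5P; split=> //.
- by rewrite size_map nle.
- apply/allP => _ /mapP [x xv ->].
  apply/forall_inP => y /set1P ->; apply/forall_inP => z /set1P ->.
  exact: connect0.
apply/forallP => i; apply/forallP => j; apply/implyP => ij.
apply/forall_inP => x xi; apply/forall_inP => y yj; apply: contra ij => xy.
have hi : (i < size vs)%N by have := ltn_ord i; rewrite [X in (_ < X)%N]size_map.
have hj : (j < size vs)%N by have := ltn_ord j; rewrite [X in (_ < X)%N]size_map.
have x0 := x; move: xi yj.
rewrite !(nth_map x0) // => /set1P xE /set1P yE.
rewrite -val_eqE /= -(nth_uniq x0 hi hj uniq_vs) -xE -yE.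
apply/eqP/inj_vs; rewrite ?inE ?xE ?yE ?mem_nth //.
by rewrite -xE -yE; apply/(fingraph.rootP sy).
Qed.

End Restriction.

(** * Exchanging the part of a forest inside G3 *)

Section Exchange.
Variables (F2 T : {set 'I_ne}).
Hypothesis F2_sub : F2 \subset G2.
Hypothesis TQ : forests G3 singles T.

Local Notation W := [set x | (x \notin vset G3) || (x \in vs)].

Lemma singles_reach x : x \in vset G3 -> exists2 y, y \in vs & connect (adj T) x y.
Proof.
move=> x3; have [|p [y [/mapP [z zv ->] /set1P ->]]] := in_forests_covered _ TQ x3.
  move=> _ /mapP [z zv ->]; split; last by rewrite sub1set vs_sub.
  by apply/set0Pn; exists z; rewrite inE.
by exists z.
Qed.

Lemma singles_uniq x y : x \in vs -> y \in vs -> connect (adj T) x y -> x = y.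
Proof.
move=> xv yv xy; apply: (index_inj x xv yv).
apply: (@in_forests_disconnected _ _ _ _ _ _ _ _ _ x y TQ) => //.
all: rewrite ?size_map ?index_mem //.
all: by rewrite (nth_map x) ?index_mem // nth_index // inE.
Qed.

Lemma W_transversal x : exists2 y, y \in W & connect (adj (F2 :|: T)) x y.
Proof.
have [x3|x3] := boolP (x \in vset G3); last by exists x; [rewrite in_set x3 | apply: connect0].
have [y yv xy] := singles_reach x3; exists y; first by rewrite inE yv orbT.
by apply: connect_adjW xy; apply: subsetUr.
Qed.

(** A tree of T contains only one vertex of [vs], so a detour through G3 leaves where it entered. *)
Lemma connect_exchange :
  {in W &, forall x y, connect (adj (F2 :|: T)) x y = connect (adj F2) x y}.
Proof.
have T3 : T \subset G3 by case/and5P: TQ.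
(* rho retracts each tree of T onto its unique vertex in vs. *)
pose rho x := if x \in vset G3
              then odflt x [pick y in vs | connect (adj T) x y] else x.
have rhoP x y : x \in vset G3 -> y \in vs -> connect (adj T) x y -> rho x = y.
  move=> x3 yv xy; rewrite /rho x3; case: pickP => [z /andP [zv xz]|/(_ y)].
    apply: singles_uniq => //; apply: connect_trans xy.
    by rewrite (connect_adj_sym src dst T).
  by rewrite yv xy.
have rhoW x : x \in W -> rho x = x.
  rewrite inE; have [x3 /= xv|x3 _] := boolP (x \in vset G3).
    exact: rhoP.
  by rewrite /rho (negPf x3).
have syF := connect_adj_sym src dst F2.
(* Edges of F2 have both ends in W, where [rho] is the identity; the two ends of an edge of T
   retract to the same vertex. *)
have inv a b : adj (F2 :|: T) a b ->
    fingraph.root (adj F2) (rho a) = fingraph.root (adj F2) (rho b).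
  case/existsP => e /andP [/setUP [eF|eT] eab].
    have ab : adj F2 a b by apply/existsP; exists e; rewrite eF.
    have inW z : z \in vset F2 -> z \in W.
      move/(subsetP (vsetW _ _ F2_sub)) => z2; rewrite inE.
      by have [/(vs_sep z2) ->|] := boolP (z \in vset G3).
    have [aF bF] := adj_vset ab; rewrite !rhoW ?inW //.
    exact/(fingraph.rootP syF)/connect1.
  have ab : adj T a b by apply/existsP; exists e; rewrite eT.
  have [/(subsetP (vsetW _ _ T3)) a3 /(subsetP (vsetW _ _ T3)) b3] := adj_vset ab.
  have [y yv bY] := singles_reach b3.
  by rewrite (rhoP b y) // (rhoP a y) // (connect_trans (connect1 ab)).
move=> x y xW yW; apply/idP/idP; last first.
  by apply: connect_adjW; apply: subsetUl.
move/(connect_invariant inv); rewrite !rhoW //.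
by move/(fingraph.rootP syF).
Qed.

Lemma ncomp_exchange :
  ncomp src dst (F2 :|: T) = #|fingraph.root (adj F2) @: W|.
Proof.
have syF := connect_adj_sym src dst F2.
have syU := connect_adj_sym src dst (F2 :|: T).
rewrite /ncomp (n_comp_transversal (W := W)) //; last first.
  by move=> x _; apply: W_transversal.
apply: card_imset_ker => x y xW yW; split.
  by move/(fingraph.rootP syU); rewrite connect_exchange // => /(fingraph.rootP syF).
move/(fingraph.rootP syF); rewrite -connect_exchange //.
by move/(fingraph.rootP syU).
Qed.

Lemma card_exchange : (#|F2 :|: T| = #|F2| + (#|vset G3| - size vs))%N.
Proof.
have T3 : T \subset G3 by case/and5P: TQ.
have -> : (#|vset G3| - size vs = #|T|)%N.
  by rewrite -(in_forests_card TQ) size_map addnK.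
rewrite cardsU; suff -> : F2 :&: T = set0 by rewrite cards0 subn0.
apply/eqP; rewrite setI_eq0; apply: disjointWl F2_sub _.
exact: disjointWr T3 disG.
Qed.

(** The right-hand side no longer mentions T, which makes any two choices of T interchangeable. *)
Lemma in_forests_exchangeE (P : seq {set 'I_nv}) :
  (forall p, p \in P -> p \subset W) ->
  forests (G2 :|: G3) P (F2 :|: T) =
  [&& #|F2| + (#|vset G3| - size vs) + #|fingraph.root (adj F2) @: W| == nv,
      #|fingraph.root (adj F2) @: W| == size P + #|~: vset (G2 :|: G3)|,
      all (fun p : {set 'I_nv} =>
             [forall x in p, forall y in p, connect (adj F2) x y]) P &
      [forall i : 'I_(size P), forall j : 'I_(size P), (i != j) ==>
        [forall x in nth set0 P i, forall y in nth set0 P j,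
           ~~ connect (adj F2) x y]]]%N.
Proof.
move=> PW; have T3 : T \subset G3 by case/and5P: TQ.
have sub : F2 :|: T \subset G2 :|: G3 by apply: setUSS.
rewrite /in_forests sub /= acyclicE card_exchange ncomp_exchange; congr [&& _, _, _ & _].
- by rewrite -ncomp_exchange (ncomp_on_vset src dst sub) eqn_add2r.
- apply: eq_in_all => p /PW /subsetP pW.
  apply: eq_forallb => x; case: (boolP (x \in p)) => //= xp.
  apply: eq_forallb => y; case: (boolP (y \in p)) => //= yp.
  by rewrite connect_exchange ?pW.
apply: eq_forallb => i; apply: eq_forallb => j; congr (_ ==> _).
apply: eq_forallb => x; case: (boolP (x \in nth set0 P i)) => //= xp.
apply: eq_forallb => y; case: (boolP (y \in nth set0 P j)) => //= yp.
rewrite connect_exchange //.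
  by have /subsetP := PW _ (mem_nth set0 (ltn_ord i)); apply.
by have /subsetP := PW _ (mem_nth set0 (ltn_ord j)); apply.
Qed.

End Exchange.

Lemma in_forests_exchange (P : seq {set 'I_nv}) (F2 T T' : {set 'I_ne}) :
  (forall p x, p \in P -> x \in p -> x \in vset G3 -> x \in vs) ->
  F2 \subset G2 -> forests G3 singles T -> forests G3 singles T' ->
  forests (G2 :|: G3) P (F2 :|: T) = forests (G2 :|: G3) P (F2 :|: T').
Proof.
move=> P_vs sub TQ TQ'.
have PW p : p \in P -> p \subset [set x | (x \notin vset G3) || (x \in vs)].
  move=> pP; apply/subsetP => x xp; rewrite inE.
  by have [/(P_vs _ _ pP xp) ->|] := boolP (x \in vset G3).
by rewrite (in_forests_exchangeE sub TQ PW) (in_forests_exchangeE sub TQ' PW).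
Qed.

Let Q := Phi src dst G3 singles.

Definition scaleG2 (p : {mpoly int[ne]}) : {mpoly int[ne]} :=
  p \mPo [tuple (if i \in G2 then 'X_i * Q else 'X_i) | i < ne].

HB.instance Definition _ := GRing.RMorphism.copy scaleG2
  (comp_mpoly [tuple (if i \in G2 then 'X_i * Q else 'X_i) | i < ne]).

Lemma scaleG2_prod (A : {set 'I_ne}) :
  scaleG2 (\prod_(e in A) 'X_e) = Q ^+ #|A :&: G2| * \prod_(e in A) 'X_e.
Proof.
rewrite rmorph_prod /= -prodr_const.
rewrite (big_mkcond (mem (A :&: G2))) (big_mkcond (mem A)) -big_mkcond /=.
rewrite [in RHS](big_mkcond (mem A)) -big_split [LHS]big_mkcond /=.
apply: eq_bigr => e _; rewrite inE; case: ifP => _; last by rewrite mul1r.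
rewrite /scaleG2 comp_mpolyXU -tnth_nth tnth_mktuple.
by case: ifP => _; rewrite ?mul1r // mulrC.
Qed.

Lemma dvd_exp_sum (I : Type) (r : seq I) (p : pred I) (f : I -> {mpoly int[ne]}) k :
  (forall i, p i -> exists q, f i = Q ^+ k * q) ->
  exists q, \sum_(i <- r | p i) f i = Q ^+ k * q.
Proof.
move=> h; apply: (big_ind (fun s => exists q, s = Q ^+ k * q)) => //.
  by exists 0; rewrite mulr0.
by move=> x y [q ->] [q' ->]; exists (q + q'); rewrite mulrDr.
Qed.

Lemma dvd_expW k m p : (k <= m)%N ->
  (exists q, p = Q ^+ m * q) -> exists q, p = Q ^+ k * q.
Proof.
by move=> le_km [q ->]; exists (Q ^+ (m - k) * q); rewrite mulrA -exprD subnKC.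
Qed.

Lemma disjG e : e \in G2 -> e \in G3 = false.
Proof. exact: disjointFr disG. Qed.

(** Write F as F2 ∪ T with T = F ∩ G3. By [in_forests_exchange] the condition on F2 is the same for
    all T counted by Q; T0 only serves to state it. *)
Lemma sum_forests_factor (P : seq {set 'I_nv}) (T0 : {set 'I_ne}) :
  (forall p x, p \in P -> x \in p -> x \in vset G3 -> x \in vs) ->
  forests G3 singles T0 ->
  \sum_(F : {set 'I_ne} | forests (G2 :|: G3) P F && forests G3 singles (F :&: G3))
     \prod_(e in (G2 :|: G3) :\: F) 'X_e =
  (\sum_(F2 : {set 'I_ne} | (F2 \subset G2) && forests (G2 :|: G3) P (F2 :|: T0))
     \prod_(e in G2 :\: F2) 'X_e) * Q.
Proof.
move=> P_vs T0Q.
rewrite (partition_big (fun F => F :&: G3) (forests G3 singles)) /=; last first.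
  by move=> F /andP [].
rewrite /Q /Phi mulr_sumr; apply: eq_bigr => T TQ.
have T3 : T \subset G3 by case/and5P: TQ.
have eT e : e \in T -> (e \in G2 = false) * (e \in G3).
  move=> eT; have e3 := subsetP T3 _ eT; split=> //.
  by apply/negP => /disjG; rewrite e3.
rewrite (reindex_onto (fun F2 => F2 :|: T) (fun F => F :&: G2)) /=; last first.
  move=> F /andP [/andP [FP _] /eqP <-]; rewrite -setIUr; apply/setIidPl.
  by case/and5P: FP.
rewrite mulr_suml; apply: eq_big => [F2|F2 /andP [_ /eqP F2E]].
  (* The reindexing condition (F2 ∪ T) ∩ G2 = F2 forces F2 into G2. *)
  have [sub|nsub] := boolP (F2 \subset G2); last first.
    apply: negbTE; rewrite negb_and; apply/orP; right.
    by apply: contra nsub => /eqP <-; apply: subsetIr.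
  have -> : (F2 :|: T) :&: G3 = T.
    apply/setP => e; rewrite !inE.
    have [/eT [_ ->]|_] := boolP (e \in T); first by rewrite orbT.
    by rewrite orbF; case: (boolP (e \in F2)) => //= /(subsetP sub)/disjG.
  have -> : (F2 :|: T) :&: G2 = F2.
    apply/setP => e; rewrite !inE.
    have [/(subsetP sub) ->|_] := boolP (e \in F2); first by [].
    by case: (boolP (e \in T)) => //= /eT [-> _].
  by rewrite TQ !eqxx !andbT /= (in_forests_exchange P_vs sub TQ T0Q).
have sub : F2 \subset G2 by rewrite -F2E subsetIr.
(* The complement of F2 ∪ T is the disjoint union of G2 \ F2 and G3 \ T. *)
rewrite -bigU /=; last first.
  rewrite disjoint_subset; apply/subsetP => e; rewrite !inE => /andP [_ /disjG ->].
  by rewrite andbF.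
apply: eq_bigl => e; rewrite !inE negb_or.
have [e2|e2] /= := boolP (e \in G2).
  rewrite (disjG e2) andbF !andbT orbF; case: (boolP (e \in T)) => [/eT [] |_].
    by rewrite e2.
  by rewrite andbT.
rewrite andbF /=; case: (boolP (e \in F2)) => // /(subsetP sub).
by rewrite (negPf e2).
Qed.

Lemma scaleG2_Phi_dvd (P : seq {set 'I_nv}) :
  (forall p, p \in P -> p != set0 /\ p \subset vset (G2 :|: G3)) ->
  (forall p x, p \in P -> x \in p -> x \in vset G3 -> x \in vs) ->
  exists q, scaleG2 (Phi src dst (G2 :|: G3) P) =
    Q ^+ ((#|G2| + #|vset G3| + size P).+1 - (#|vset (G2 :|: G3)| + size vs)) * q.
Proof.
move=> vP P_vs; set a := subn _ _.
have cardF F : forests (G2 :|: G3) P F ->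
    (#|F :&: G3| + #|G2| + size P = #|G2 :\: F| + #|vset (G2 :|: G3)|)%N.
  move=> FP; rewrite -(in_forests_card FP).
  have sub : F \subset G2 :|: G3 by case/and5P: FP.
  have cF : #|F| = (#|F :&: G2| + #|F :&: G3|)%N.
    rewrite -(cardsID G2 F); congr (_ + _)%N; congr #|pred_of_set _|.
    apply/setP => e; rewrite !inE andbC; apply: andb_id2l => eF.
    have := subsetP sub _ eF; rewrite inE.
    by case: (boolP (e \in G2)) => [/disjG ->|_ /= ->].
  have := cardsID F G2; rewrite setIC cF; lia.
rewrite /Phi (bigID (fun F => forests G3 singles (F :&: G3))) rmorphD /=.
set good := \sum_(F | _ && _) _; set bad := \sum_(F | _ && ~~ _) _.
(* Here F has at least |V(G3)| - n + 1 edges in G3, so by [cardF] at least a edges of G2 lie outside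
   F. *)
have [q1 ->] : exists q, scaleG2 bad = Q ^+ a * q.
  rewrite rmorph_sum; apply: dvd_exp_sum => F /andP [FP nF].
  rewrite /= scaleG2_prod.
  apply: (@dvd_expW _ #|((G2 :|: G3) :\: F) :&: G2|); last by eexists.
  have -> : ((G2 :|: G3) :\: F) :&: G2 = G2 :\: F.
    by apply/setP => e; rewrite !inE; case: (e \in G2); rewrite ?andbF ?andbT.
  have := restriction_forest_or_few vP P_vs FP nF.
  have := cardF F FP; rewrite /a; lia.
suff [q2 ->] : exists q, scaleG2 good = Q ^+ a * q.
  by exists (q2 + q1); rewrite mulrDr.
(* The factorization needs some forest counted by Q; if there is none, [good] is an empty sum. *)
have [[T0 T0Q]|none] : {T0 | forests G3 singles T0} + (forall T, ~~ forests G3 singles T).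
  case: (pickP (forests G3 singles)) => [T h|h]; first by left; exists T.
  by right=> T; rewrite h.
rewrite /good (sum_forests_factor P_vs T0Q) rmorphM /=.
(* Q involves only variables of G3, which the substitution fixes. *)
have -> : scaleG2 Q = Q.
  rewrite {1}/Q /Phi rmorph_sum; apply: eq_bigr => T _ /=; rewrite scaleG2_prod.
  suff -> : (G3 :\: T) :&: G2 = set0 by rewrite cards0 mul1r.
  apply/setP => e; rewrite !inE; case: (boolP (e \in G2)); rewrite ?andbF //.
  by move/disjG ->; rewrite andbF.
(* Now |G2 \ F2| is exactly a - 1; the missing factor is the Q split off above. *)
have [q ->] : exists q, scaleG2 (\sum_(F2 : {set 'I_ne} |
    (F2 \subset G2) && forests (G2 :|: G3) P (F2 :|: T0))
     \prod_(e in G2 :\: F2) 'X_e) = Q ^+ a.-1 * q.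
  rewrite rmorph_sum; apply: dvd_exp_sum => F2 /andP [sub FP].
  rewrite /= scaleG2_prod (setIidPl (subsetDl G2 F2)).
  apply: (@dvd_expW _ #|G2 :\: F2|); last by eexists.
  have := in_forests_card FP; rewrite (card_exchange sub T0Q).
  have := in_forests_card T0Q; rewrite size_map.
  have := cardsID F2 G2; rewrite (setIidPr sub) /a; lia.
rewrite mulrAC -exprSr; apply: (@dvd_expW _ a.-1.+1); last by eexists.
exact: leqSpred.
by exists 0; rewrite mulr0 /good big_pred0 ?rmorph0 // => F; rewrite (negPf (none _)) andbF.
Qed.

End Separation.

(** * The divisibility *)

(** Terms of the wrong degree cancel among themselves. After homogenizing and clearing the shifts a
    and k, compare the coefficients of T^(b + k). *)
Lemma homogeneous_part (n : nat) (I : eqType) (L : seq I) (f : I -> {mpoly int[n]})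
    (d : I -> nat) (a b k : nat) :
  homog_deg a b (\sum_(t <- L) f t) -> (forall t, homog_deg k (d t) (f t)) ->
  \sum_(t <- L) f t = \sum_(t <- L | (d t + a == b + k)%N) f t.
Proof.
move=> /(@homog_degW _ _ _ k) hD hf; set D := \sum_(t <- L) f t in hD *.
have hD' : homogenize D * 'X^(a + k) = \sum_(t <- L) f t *: 'X^(d t + a).
  rewrite /D rmorph_sum /= mulr_suml. apply: eq_bigr => t _.
  by have /(@homog_degW _ _ _ a) := hf t; rewrite /homog_deg [(k + a)%N]addnC.
have := congr1 (fun p : {poly {mpoly int[n]}} => p`_(b + k)) (etrans (esym hD) hD').
rewrite coefZ coefXn eqxx mulr1 coef_sum => ->; rewrite [RHS]big_mkcond.
apply: eq_bigr => t _; rewrite coefZ coefXn eq_sym.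
by case: eqP => _; rewrite ?mulr1 ?mulr0.
Qed.

Section Connectivity.
Variables (nv ne : nat) (src dst : 'I_ne -> 'I_nv).

Lemma src_vset (S : {set 'I_ne}) e : e \in S -> src e \in vset src dst S.
Proof. by move=> eS; rewrite inE; apply/existsP; exists e; rewrite eS eqxx. Qed.

Lemma vset_setT (e0 : 'I_ne) : graph_connected src dst -> vset src dst setT = setT.
Proof.
move=> conn; apply/setP => x; rewrite [RHS]inE.
have e0T : src e0 \in vset src dst setT by apply: src_vset; rewrite inE.
have cl := @closed_vset _ _ src dst _ _ (subxx setT).
by have := closed_connect cl (conn (src e0) x); rewrite e0T => <-.
Qed.

Lemma ncomp_on_gt0 (S : {set 'I_ne}) : S != set0 ->
  (0 < ncomp_on src dst S (vset src dst S))%N.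
Proof.
case/set0Pn => e eS.
rewrite /ncomp_on (n_comp_transversal (W := vset src dst S)) //.
- by rewrite card_gt0; apply/set0Pn; eexists; apply: imset_f (src_vset eS).
- exact: connect_adj_sym.
- exact: closed_vset.
by move=> x xS; exists x.
Qed.

Lemma ncomp_on_connected (S : {set 'I_ne}) : S != set0 ->
  sub_connected src dst S -> ncomp_on src dst S (vset src dst S) = 1%N.
Proof.
case/set0Pn => e eS conn; have sS := src_vset eS.
rewrite /ncomp_on (n_comp_transversal (W := [set src e])).
- by rewrite imset_set1 cards1.
- exact: connect_adj_sym.
- exact: closed_vset.
- by move=> x /set1P ->.
by move=> x xS; exists (src e); rewrite ?inE //; apply: conn.
Qed.
End Connectivity.

(** The degree equation gives p + p' = g1 + 2 - 2 v. Then the sum of the exponents minus (g2 + 1) is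
    at least the left side of (v) plus 2 (c3 - 1). The bound VH <= h + 1 makes the subtraction in bH
    exact, while truncation in the exponents can only increase them. *)
Lemma exponent_bound (nv ne g1 g2 g3 h VH V3 U v n bH b3 c3 p p' : nat) :
  (0 < nv)%N -> ne = (g1 + h)%N -> h = (g2 + g3)%N -> nv = (VH + v)%N ->
  (VH <= h + 1)%N -> bH = (h + (1 + v) - nv)%N ->
  (V3 + U = nv)%N -> b3 = (g3 + (c3 + U) - nv)%N -> (0 < c3)%N ->
  0 <= 2 * bH%:Z - 2 * b3%:Z + g1%:Z - g2%:Z - 2 * v%:Z - 2 * n%:Z + 3 ->
  (h + p + (h + p') + (nv.-1.*2 + g1) = ne.*2 + (VH + VH))%N ->
  (g2 < (g2 + V3 + p).+1 - (VH + n) + ((g2 + V3 + p').+1 - (VH + n)))%N.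
Proof. lia. Qed.

Unset Implicit Arguments. Set Strict Implicit.

Theorem mainTheorem9 (nv ne : nat) (src dst : 'I_ne -> 'I_nv) (v0 : 'I_nv)
    (G1 G2 G3 : {set 'I_ne}) (vs : seq 'I_nv) (nvtx : nat)
    (es : seq 'I_ne) (D : {mpoly int[ne]}) :
  four_point src dst -> primitive src dst ->
  (* G1, G2, G3 partition the edge set *)
  G1 != set0 -> G2 != set0 -> G3 != set0 ->
  [disjoint G1 & G2] -> [disjoint G1 & G3] -> [disjoint G2 & G3] ->
  G1 :|: G2 :|: G3 = setT ->
  (* (i) *)
  sub_connected src dst (G2 :|: G3) ->
  (* (ii) the common vertices are v_1, ..., v_n (vs), n = size vs *)
  uniq vs -> [set x in vs] = vset src dst (G1 :|: G2) :&: vset src dst G3 ->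
  (* (iii) *)
  nvtx = #|vset src dst G1 :\: vset src dst (G2 :|: G3)| ->
  (* (iv) *)
  uniq es -> [set e in es] = G1 -> (5 <= size es)%N ->
  DR src dst v0 es D -> D != 0 ->
  (exists L : seq (bool * seq {set 'I_nv} * seq {set 'I_nv}),
     D = \sum_(t <- L) (-1) ^+ t.1.1 * Phi src dst (G2 :|: G3) t.1.2
                                      * Phi src dst (G2 :|: G3) t.2 /\
     (forall t, t \in L ->
        valid_partition src dst (G2 :|: G3) t.1.2 /\
        valid_partition src dst (G2 :|: G3) t.2 /\
        (forall p x, (p \in t.1.2) || (p \in t.2) -> x \in p ->
           x \in vset src dst G3 -> x \in vs))) ->
  (* (v) *)
  (0 <= 2 * (betti src dst (G2 :|: G3))%:Z - 2 * (betti src dst G3)%:Z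
        + (#|G1|)%:Z - (#|G2|)%:Z - 2 * nvtx%:Z - 2 * (size vs)%:Z + 3)%R ->
  let Q := Phi src dst G3 [seq [set x] | x <- vs] in
  let Dt := D \mPo [tuple (if i \in G2 then 'X_i * Q else 'X_i) | i < ne] in
  exists q : {mpoly int[ne]}, Dt = Q ^+ (#|G2|).+1 * q.
Proof.
move=> [conn _] _ G1n0 _ G3n0 d12 d13 d23 cover Hconn uvs vsE nE ues esE _ DRD _.
case=> L [DE Lval] cond Q Dt.
have vsP x : (x \in vs) = (x \in vset src dst (G1 :|: G2)) && (x \in vset src dst G3).
  by have /setP/(_ x) := vsE; rewrite inE in_setI.
have vs_sub : {subset vs <= vset src dst G3} by move=> x; rewrite vsP => /andP [].
have vs_sep x : x \in vset src dst G2 -> x \in vset src dst G3 -> x \in vs.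
  by move=> x2 x3; rewrite vsP x3 vsetU in_setU x2 orbT.
set H := G2 :|: G3 in Hconn nE DE Lval cond *.
have [e3 e3G] := set0Pn _ G3n0.
have Hn0 : H != set0 by apply/set0Pn; exists e3; rewrite inE e3G orbT.
have cG3 : #|G2 :|: G3| = (#|G2| + #|G3|)%N by apply/eqP; rewrite (leq_card_setU G2 G3).2.
have cE : ne = (#|G1| + #|H|)%N.
  rewrite -[LHS]card_ord -cardsT -cover -setUA; apply/eqP; rewrite (leq_card_setU G1 H).2.
  by rewrite -setI_eq0 setIUr setU_eq0 !setI_eq0 d12 d13.
have VT := vset_setT e3 conn.
(* By connectedness every vertex is an endpoint of some edge, so those outside H are endpoints of
   edges of G1. *)
have UE : #|~: vset src dst H| = nvtx.
  rewrite nE; congr #|pred_of_set _|.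
  apply/setP => x; rewrite in_setC in_setD andbC andb_idl // => xH.
  have : x \in vset src dst setT by rewrite VT inE.
  by rewrite -cover -setUA vsetU in_setU -/H (negPf xH) orbF.
have nvE := card_setC_vset src dst H; rewrite UE in nvE.
have nc1 := ncomp_on_vset src dst (subxx H).
rewrite (ncomp_on_connected Hn0 Hconn) UE in nc1.
have VHle := nv_le_card_ncomp src dst H; rewrite nc1 -nvE addnA leq_add2r in VHle.
have bH := bettiE src dst H; rewrite nc1 in bH.
have b3 := bettiE src dst G3; rewrite (ncomp_on_vset src dst (subxx G3)) in b3.
have c3 := ncomp_on_gt0 src dst G3n0.
have V3E := card_setC_vset src dst G3.
have es_size : size es = #|G1| by rewrite -esE cardsE; apply/esym/card_uniqP.
have hD := homog_deg_DR DRD ues.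
pose f (t : bool * seq {set 'I_nv} * seq {set 'I_nv}) : {mpoly int[ne]} :=
  (-1) ^+ t.1.1 * Phi src dst H t.1.2 * Phi src dst H t.2.
have hf t : homog_deg (#|vset src dst H| + #|vset src dst H|)
               (#|H| + size t.1.2 + (#|H| + size t.2)) (f t).
  by rewrite /f -mulrA; apply/homog_deg_sign/homog_degM; apply: homog_deg_Phi.
have DE' : D = \sum_(t <- L) f t by [].
(* From here on only pairs of partitions with the prescribed |P| + |P'| remain in the sum. *)
rewrite DE' in hD; have DE2 := homogeneous_part hD hf.
have -> : Dt = scaleG2 src dst G2 G3 vs D by [].
rewrite DE' DE2 big_seq_cond rmorph_sum.
apply: dvd_exp_sum => t /andP [tL /eqP te] /=.
have [[vP1 _] [[vP2 _] P_vs]] := Lval t tL.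
have [q1 e1] := scaleG2_Phi_dvd d23 uvs vs_sub vs_sep vP1
  (fun p x h => P_vs p x (introT orP (or_introl h))).
have [q2 e2] := scaleG2_Phi_dvd d23 uvs vs_sub vs_sep vP2
  (fun p x h => P_vs p x (introT orP (or_intror h))).
rewrite /f rmorphM rmorphM rmorph_sign /= e1 e2 -/Q.
set a1 := subn _ _; set a2 := subn _ _.
apply: (@dvd_expW _ _ _ _ _ _ _ (a1 + a2)); last first.
  exists ((-1) ^+ t.1.1 * q1 * q2); rewrite exprD.
  by rewrite [_ * (Q ^+ a1 * q1)]mulrCA mulrACA.
rewrite es_size in te.
exact: (exponent_bound (leq_ltn_trans (leq0n v0) (ltn_ord v0)) cE cG3 (esym nvE)
  VHle bH V3E b3 c3 cond te).
Qed.
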